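(* Let $G$ be a countable group satisfying property RD with respect to a length function $\mathcal{L}$, and let $\mu$ be a non-degenerate probability measure on $G$ with finite Shannon entropy and finite $\log(1+\mathcal{L})$-moment, i.e.\ $\sum_{s}\mu(s)\log(1+\mathcal{L}(s))<\infty$. Let $(X,\xi)$ be a $(G,\mu)$-stationary space such that the Koopman representation $\pi_X$ is weakly contained in the left-regular representation $\lambda_G$. Then \[ h_\mu(X,\xi)=h(G,\mu)=-2\lim_{n\to\infty}\frac1n\sum_{s\in G}\mu^{*n}(s)\log\Xi_X(s). \]
   Context: $G$ is a countable discrete group; $\mu^{*n}$ is the $n$-fold convolution power of $\mu$ ($\mu*\nu(s)=\sum_t\mu(t)\nu(t^{-1}s)$). $\mu$ is non-degenerate if its support generates $G$ as a semigroup. Shannon entropy $H(G,\mu)=-\sum_s\mu(s)\log\mu(s)$; Avez entropy $h(G,\mu)=\lim_n\frac1nH(G,\mu^{*n})$. A length function satisfies $\mathcal{L}(e)=0$, $\mathcal{L}(s^{-1})=\mathcal{L}(s)$, $\mathcal{L}(st)\le\mathcal{L}(s)+\mathcal{L}(t)$. Property RD w.r.t.\ $\mathcal{L}$: for some $d\in\mathbb{N}$ the inclusion $\mathbb{C}[G]\hookrightarrow C^*_r(G)$ extends to a bounded map $\ell^2(G,\omega)\to C^*_r(G)$ with $\omega(s)=(1+\mathcal{L}(s))^d$, $\ell^2(G,\omega)=\{f:\sum|f|^2\omega^2<\infty\}$. A $(G,\mu)$-stationary space is a standard probability space $(X,\xi)$ with a measurable non-singular $G$-action such that $\sum_s\mu(s)\xi(s^{-1}A)=\xi(A)$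 for all measurable $A$. Write $\rho(s,x)=\frac{d(s^{-1}\xi)}{d\xi}(x)$, where $(s\xi)(A)=\xi(s^{-1}A)$. The Koopman representation $\pi_X$ on $L^2(X,\xi)$ is $[\pi_X(s)f](x)=\big[\frac{d(s\xi)}{d\xi}(x)\big]^{1/2}f(s^{-1}x)$, and $\Xi_X(s)=\langle\pi_X(s)1,1\rangle=\int_X\rho(s,x)^{1/2}d\xi(x)$. The Furstenberg entropy is $h_\mu(X,\xi)=-\sum_s\mu(s)\int_X\log\rho(s,x)\,d\xi(x)$. *)

(* Defs.v *)
From HB Require Import structures.
From mathcomp Require Import all_boot all_order all_algebra.
From mathcomp Require Import all_classical all_reals all_analysis.
From mathcomp Require Import complex.

Set Implicit Arguments.
Unset Strict Implicit.
Unset Printing Implicit Defensive.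

Import Order.TTheory GRing.Theory Num.Theory.
Local Open Scope classical_set_scope.
Local Open Scope ring_scope.

HB.structure Definition CountGroup := {G of Group G & Countable G}.

Section GroupSide.
Variables (R : realType) (G : CountGroup.type).

Definition is_prob_on_group (mu : G -> R) : Prop :=
  (forall s, 0 <= mu s) /\ (esum setT (fun s => (mu s)%:E) = 1%E).

Definition conv (mu nu : G -> R) : G -> R :=
  fun s => fine (esum setT (fun t => (mu t * nu (t^-1 * s)%g)%:E)).

Fixpoint conv_pow (mu : G -> R) (n : nat) : G -> R :=
  match n with
  | 0 => fun s => if s == 1%g then 1 else 0
  | n'.+1 => conv (conv_pow mu n') mu
  end.

Definition shannon_entropy (mu : G -> R) : \bar R :=
  esum setT (fun s => (- (mu s * ln (mu s)))%:E).

Definition avez_entropy (mu : G -> R) : \bar R :=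
  lim ((fun n : nat => ((n%:R^-1)%:E * shannon_entropy (conv_pow mu n))%E) @ \oo).

Definition non_degenerate (mu : G -> R) : Prop :=
  forall g : G, exists w : seq G,
    [/\ w != [::], all (fun s => 0 < mu s) w & foldr (fun x y => (x * y)%g) 1%g w = g].

Definition is_length_function (L : G -> R) : Prop :=
  [/\ L 1%g = 0, (forall s, L (s^-1)%g = L s) & (forall s t, L (s * t)%g <= L s + L t)].

Definition finite_log_moment (mu : G -> R) (L : G -> R) : Prop :=
  (esum setT (fun s => (mu s * ln (1 + L s))%:E) < +oo)%E.

Definition supp (f : G -> R[i]) : set G := [set s | f s != 0].
Definition fin_supp (f : G -> R[i]) : Prop := finite_set (supp f).

Definition normsq (z : R[i]) : R := complex.Re z ^+ 2 + complex.Im z ^+ 2.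

Definition reg_conv (f g : G -> R[i]) : G -> R[i] :=
  fun s => \sum_(t \in supp f) (f t * g (t^-1 * s)%g).

Definition l2sq (g : G -> R[i]) : R := \sum_(s \in supp g) normsq (g s).

Definition l2wsq (L : G -> R) (d : nat) (f : G -> R[i]) : R :=
  \sum_(s \in supp f) (normsq (f s) * ((1 + L s) ^+ d) ^+ 2).

(* Property RD w.r.t. L: for some d, the inclusion C[G] -> C*_r(G) extends to a
   bounded map l^2(G,omega) -> C*_r(G), i.e. ||lambda(f)||_op <= C ||f||_{2,omega}
   for all f in C[G] (the operator norm being computed on the dense subspace C[G]
   of l^2(G)).  Everything is squared. *)
Definition property_RD (L : G -> R) : Prop :=
  exists (d : nat) (C : R), forall f g : G -> R[i], fin_supp f -> fin_supp g ->
    l2sq (reg_conv f g) <= C * l2wsq L d f * l2sq g.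

End GroupSide.

Section SpaceSide.
Variables (R : realType) (G : CountGroup.type).
Variables (dX : measure_display) (X : measurableType dX).

Definition standard_borel : Prop :=
  exists phi : X -> R,
    [/\ measurable_fun setT phi, injective phi, measurable (range phi)
      & forall A : set X, measurable A -> measurable (phi @` A)].

Definition measurable_action (a : G -> X -> X) : Prop :=
  [/\ (forall x, a 1%g x = x),
      (forall s t x, a (s * t)%g x = a s (a t x))
    & (forall s, measurable_fun setT (a s))].

Definition non_singular (a : G -> X -> X) (xi : probability X R) : Prop :=
  forall s (A : set X), measurable A -> (xi (a s @^-1` A) = 0%E <-> xi A = 0%E).

Definition stationary (mu : G -> R) (a : G -> X -> X) (xi : probability X R) : Prop :=
  forall A : set X, measurable A ->
    esum setT (fun s => ((mu s)%:E * xi (a s @^-1` A))%E) = xi A.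

(* rho(s,.) is (a version of) the Radon-Nikodym derivative d(s^-1 xi)/d xi,
   where (s^-1 xi)(A) = xi(s A) = xi((a s^-1)^-1 (A)). *)
Definition is_RN_cocycle (a : G -> X -> X) (xi : probability X R) (rho : G -> X -> R) : Prop :=
  forall s, [/\ measurable_fun setT (rho s), (forall x, 0 <= rho s x)
    & forall A : set X, measurable A ->
        xi (a (s^-1)%g @^-1` A) = (\int[xi]_(x in A) (rho s x)%:E)%E].

Definition L2sq (xi : probability X R) (h : X -> R[i]) : \bar R :=
  (\int[xi]_x (normsq (h x))%:E)%E.

Definition in_L2 (xi : probability X R) (h : X -> R[i]) : Prop :=
  [/\ measurable_fun setT (fun x => complex.Re (h x)),
      measurable_fun setT (fun x => complex.Im (h x))
    & (L2sq xi h < +oo)%E].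

(* Koopman representation:
   [pi(s) h](x) = (d(s xi)/d xi (x))^{1/2} h(s^-1 x),  d(s xi)/d xi = rho(s^-1, .),
   extended linearly to f in C[G]: pi(f) = sum_s f(s) pi(s). *)
Definition koopman (a : G -> X -> X) (rho : G -> X -> R) (f : G -> R[i]) (h : X -> R[i]) :
    X -> R[i] :=
  fun x => \sum_(s \in supp f)
             (f s * (((Num.sqrt (rho (s^-1)%g x))%:C)%C * h (a (s^-1)%g x))).

(* pi_X weakly contained in lambda_G:  ||pi_X(f)|| <= ||lambda_G(f)|| for all f in C[G] *)
Definition weakly_contained_in_regular (xi : probability X R) (a : G -> X -> X)
    (rho : G -> X -> R) : Prop :=
  forall f : G -> R[i], fin_supp f ->
  forall c : R,
    (forall g : G -> R[i], fin_supp g -> l2sq (reg_conv f g) <= c * l2sq g) ->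
    (forall h : X -> R[i], in_L2 xi h ->
       (L2sq xi (koopman a rho f h) <= c%:E * L2sq xi h)%E).

(* Xi_X(s) = <pi_X(s) 1, 1> = int rho(s,x)^{1/2} dxi(x) *)
Definition Xi (xi : probability X R) (rho : G -> X -> R) (s : G) : R :=
  fine (\int[xi]_x (Num.sqrt (rho s x))%:E)%E.

Definition furstenberg_entropy (mu : G -> R) (xi : probability X R) (rho : G -> X -> R) :
    \bar R :=
  esum setT (fun s => ((mu s)%:E * (\int[xi]_x (- ln (rho s x))%:E))%E).

End SpaceSide.

(* Main.v *)
(* Write I(s) = -int log rho(s,x) dxi(x), so that h_mu(X,xi) = sum_s mu(s) I(s) =: h.
   The cocycle identity rho(st,x) = rho(s,tx) rho(t,x) and stationarity give
   sum_t mu(t) I(st) = I(s) + h, hence sum_s mu^{*n}(s) I(s) = n h.  Stationarity also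
   gives rho(s,.) >= mu^{*n}(s) a.e., so n h <= H(mu^{*n}).  Conversely, property RD and
   weak containment give sum_s Xi(s)^2 / (1+L(s))^{2d} <= C, and comparing mu^{*n} with
   this weight (Gibbs' inequality) yields
     H(mu^{*n}) <= -2 sum mu^{*n} log Xi + 2d sum mu^{*n} log(1+L) + C,
   where the log-moment is o(n), while Jensen's inequality gives -2 log Xi <= I.
   Therefore n h <= H(mu^{*n}) <= -2 sum mu^{*n} log Xi + o(n) <= n h + o(n). *)

Require Import Defs.
From HB Require Import structures.
From mathcomp Require Import all_boot all_order all_algebra.
From mathcomp Require Import all_classical all_reals all_analysis.
From mathcomp Require Import measurable_realfun complex ring lra.

Set Implicit Arguments.
Unset Strict Implicit.
Unset Printing Implicit Defensive.

Import Order.TTheory GRing.Theory Num.Theory.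
Import numFieldNormedType.Exports.
Local Open Scope classical_set_scope.
Local Open Scope ring_scope.

(** * Sums of nonnegative extended reals *)

Lemma esumZl (R : realType) (T : choiceType) (I : set T) (c : R) (f : T -> \bar R) :
  0 <= c -> (forall i, 0 <= f i)%E ->
  (\esum_(i in I) (c%:E * f i) = c%:E * \esum_(i in I) f i)%E.
Proof.
have le_esumZ (b : R) (g : T -> \bar R) : 0 <= b -> (forall i, 0 <= g i)%E ->
    (\esum_(i in I) (b%:E * g i) <= b%:E * \esum_(i in I) g i)%E.
  move=> b0 g0; apply: ge_ereal_sup => _ [X IX <-].
  rewrite -ge0_mule_fsumr//; apply: lee_wpmul2l; first by rewrite lee_fin.
  by apply: ereal_sup_ubound; exists X.
move=> + f0; rewrite le_eqVlt => /predU1P[<-|c0].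
  by rewrite mul0e esum1// => i _; rewrite mul0e.
apply/eqP; rewrite eq_le; apply/andP; split.
  by apply: le_esumZ => //; exact: ltW.
(* The reverse bound is the one already proved, for the scalar [c^-1] and the family [c * f]. *)
rewrite -lee_pdivlMl//.
apply: le_trans (@le_esumZ c^-1 (fun i => c%:E * f i)%E _ _).
- by apply: le_esum => i _; rewrite muleA -EFinM mulVf ?gt_eqF// mul1e.
- by rewrite invr_ge0 ltW.
- by move=> i; rewrite mule_ge0// lee_fin ltW.
Qed.

Lemma le_term_esum (R : realType) (T : choiceType) (f : T -> \bar R) (x : T) :
  (forall i, 0 <= f i)%E -> (f x <= \esum_(i in setT) f i)%E.
Proof.
by move=> f0; apply: esum_ge; exists [set x]; [split|rewrite fsbig_set1].
Qed.

(** * Expectations over the group and convolution powers *)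

Section Convolution.
Context {R : realType} {G : CountGroup.type}.
Implicit Types (mu nu p : G -> R) (F : G -> R).

(** For nonnegative terms this is the expectation of [F] under [p], possibly infinite. *)
Definition gmean p F : \bar R := (\esum_(s in setT) (p s * F s)%:E)%E.

Lemma esum_translate (f : G -> \bar R) (s : G) :
  (\esum_(g in setT) f g = \esum_(g in setT) f (s * g)%g)%E.
Proof.
apply: reindex_esum; split => //.
- by move=> x y _ _ /(congr1 (fun z => s^-1 * z)%g); rewrite !mulKg.
- by move=> x _; exists (s^-1 * x)%g => //; rewrite mulVKg.
Qed.

Lemma prob_ge0 p s : is_prob_on_group p -> 0 <= p s.
Proof. by case. Qed.

Lemma prob_le1 p s : is_prob_on_group p -> p s <= 1.
Proof.
move=> [p0 p1]; rewrite -lee_fin -p1.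
by apply: (@le_term_esum R G (fun s => (p s)%:E)) => i; rewrite lee_fin.
Qed.

Lemma gmean_ge0 p F : (forall s, 0 <= p s) -> (forall s, 0 <= F s) ->
  (0 <= gmean p F)%E.
Proof. by move=> p0 F0; apply: esum_ge0 => s _; rewrite lee_fin mulr_ge0. Qed.

Lemma le_gmean p F F' : (forall s, 0 <= p s) -> (forall s, 0 < p s -> F s <= F' s) ->
  (gmean p F <= gmean p F')%E.
Proof.
move=> p0 FF; apply: le_esum => s _; rewrite lee_fin.
have := p0 s; rewrite le_eqVlt => /predU1P[<-|ps]; first by rewrite !mul0r.
by rewrite ler_pM2l// FF.
Qed.

Lemma gmeanD p F F' : (forall s, 0 <= p s) -> (forall s, 0 <= F s) ->
  (forall s, 0 <= F' s) -> gmean p (fun s => F s + F' s) = (gmean p F + gmean p F')%E.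
Proof.
move=> p0 F0 F'0; rewrite -esumD; do ?by move=> s _; rewrite lee_fin mulr_ge0.
by apply: eq_esum => s _; rewrite mulrDr EFinD.
Qed.

Lemma gmeanZ p F (c : R) : 0 <= c -> (forall s, 0 <= p s) -> (forall s, 0 <= F s) ->
  gmean p (fun s => c * F s) = (c%:E * gmean p F)%E.
Proof.
move=> c0 p0 F0; rewrite -esumZl//; last by move=> s; rewrite lee_fin mulr_ge0.
by apply: eq_esum => s _; rewrite mulrCA EFinM.
Qed.

Lemma gmean_cst p (c : R) : is_prob_on_group p -> 0 <= c ->
  gmean p (fun=> c) = c%:E.
Proof.
move=> [p0 p1] c0; rewrite -[RHS]mule1 -p1 -esumZl//.
by apply: eq_esum => s _; rewrite mulrC EFinM.
Qed.

(** [conv] takes [fine] of this sum, so finiteness is what makes its values meaningful. Since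
    [mu <= 1], the sum is dominated by the total mass of [nu]. *)
Lemma conv_fin_num nu mu s : is_prob_on_group nu -> is_prob_on_group mu ->
  (\esum_(t in setT) (nu t * mu (t^-1 * s)%g)%:E)%E \is a fin_num.
Proof.
move=> nuP muP; rewrite ge0_fin_numE.
  apply: (@le_lt_trans _ _ 1%E); last by rewrite ltry.
  rewrite -nuP.2; apply: le_esum => t _; rewrite lee_fin ler_piMr//.
    exact: prob_ge0 nuP.
  exact: prob_le1 muP.
by apply: esum_ge0 => t _; rewrite lee_fin mulr_ge0//; apply: prob_ge0.
Qed.

Lemma conv_ge0 nu mu s : is_prob_on_group nu -> is_prob_on_group mu ->
  0 <= Defs.conv nu mu s.
Proof.
move=> nuP muP; apply: fine_ge0; apply: esum_ge0 => t _.
by rewrite lee_fin mulr_ge0//; apply: prob_ge0.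
Qed.

(** Tonelli exchanges the two sums, and the left translation [g = s * t] then removes [s^-1] from
    the argument of [mu]. Iterated convolutions are handled through this formula. *)
Lemma gmean_conv nu mu F : is_prob_on_group nu -> is_prob_on_group mu ->
    (forall s, 0 <= F s) ->
  gmean (Defs.conv nu mu) F =
  (\esum_(s in setT) ((nu s)%:E * gmean mu (fun t => F (s * t)%g)))%E.
Proof.
move=> nuP muP F0.
have nu0 s : 0 <= nu s by apply: prob_ge0.
have mu0 s : 0 <= mu s by apply: prob_ge0.
pose k (s g : G) := (nu s * mu (s^-1 * g)%g * F g)%:E.
have k0 s g : (0 <= k s g)%E by rewrite lee_fin !mulr_ge0.
transitivity (\esum_(g in setT) \esum_(s in setT) k s g)%E.
  apply: eq_esum => g _; rewrite EFinM fineK ?conv_fin_num// muleC -esumZl//.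
    by apply: eq_esum => s _; rewrite /k -EFinM mulrC.
  by move=> s; rewrite lee_fin mulr_ge0.
rewrite (@esum_esum R G G setT (fun=> setT) (fun g s => k s g))//.
rewrite (reindex_esum setT _ (fun x : G * G => (x.2, x.1))); last first.
  split => //=; first by move=> [u v] [u' v'] _ _ [-> ->].
  by move=> [u v] _ /=; exists (v, u).
have -> : [set: G * G] = setT `*`` (fun=> setT) by apply/seteqP; split.
rewrite -(@esum_esum R G G setT (fun=> setT) k)//.
apply: eq_esum => s _; rewrite (esum_translate _ s) -esumZl//; last first.
  by move=> t; rewrite lee_fin mulr_ge0.
by apply: eq_esum => t _; rewrite /k mulKg -mulrA EFinM.
Qed.

Lemma conv_prob nu mu : is_prob_on_group nu -> is_prob_on_group mu ->
  is_prob_on_group (Defs.conv nu mu).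
Proof.
move=> nuP muP; split => [s|]; first exact: conv_ge0.
have := @gmean_conv _ _ (fun=> 1) nuP muP (fun=> ler01).
rewrite [X in X = _]/gmean; under eq_esum do rewrite mulr1.
move=> ->; rewrite -[RHS]nuP.2; apply: eq_esum => s _.
by rewrite (@gmean_cst _ 1 muP)// mule1.
Qed.

Lemma conv_gt0 nu mu s t : is_prob_on_group nu -> is_prob_on_group mu ->
  0 < nu s -> 0 < mu t -> 0 < Defs.conv nu mu (s * t)%g.
Proof.
move=> nuP muP nus mut; rewrite -lte_fin fineK ?conv_fin_num//.
pose f u := (nu u * mu (u^-1 * (s * t))%g)%:E.
apply: (@lt_le_trans _ _ (f s)); first by rewrite lte_fin mulKg mulr_gt0.
by apply: le_term_esum => u; rewrite lee_fin mulr_ge0//; apply: prob_ge0.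
Qed.

Lemma gmean_conv_pow0 mu F : (forall s, 0 <= F s) ->
  gmean (conv_pow mu 0) F = (F 1%g)%:E.
Proof.
move=> F0; rewrite -(@esum_set1 R G 1%g (fun s => (F s)%:E)) ?lee_fin//.
rewrite [RHS]esum_mkcond; apply: eq_esum => s _ /=.
by rewrite in_set1; case: eqVneq => _; rewrite ?mul1r ?mul0r.
Qed.

Lemma conv_pow_prob mu n : is_prob_on_group mu -> is_prob_on_group (conv_pow mu n).
Proof.
move=> muP; elim: n => [|n IH]; last exact: conv_prob.
split => [s|]; first by rewrite /=; case: ifP.
have := @gmean_conv_pow0 mu (fun=> 1) (fun=> ler01); rewrite /gmean.
by under eq_esum do rewrite mulr1.
Qed.

Lemma conv_pow_gt0 mu s : is_prob_on_group mu -> non_degenerate mu ->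
  exists n, 0 < conv_pow mu n s.
Proof.
move=> muP /(_ s)[w [_ wpos <-]]; exists (size w); move: wpos.
(* [conv_pow] multiplies by [mu] on the right, so the word is built up from its last letter. *)
elim/last_ind: w {s} => [|w t IH]; first by rewrite /= eqxx.
rewrite all_rcons => /andP[mut /IH IHw]; rewrite size_rcons /=.
have -> : foldr (fun x y => x * y)%g 1%g (rcons w t) =
    (foldr (fun x y => x * y) 1 w * t)%g.
  by elim: w {IH IHw} => [|x w IH] /=; rewrite ?mulg1 ?mul1g// IH mulgA.
by apply: conv_gt0 => //; exact: conv_pow_prob.
Qed.

End Convolution.

(** * Sublinear growth of the logarithmic moment *)

Section LogMoment.
Context {R : realType} {G : CountGroup.type}.
Variables (mu : G -> R) (L : G -> R).
Hypotheses (muP : is_prob_on_group mu) (lenL : is_length_function L).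

Lemma length_ge0 s : 0 <= L s.
Proof.
case: lenL => L1 LV LM; have := LM s s^-1%g.
by rewrite mulgV L1 LV; lra.
Qed.

Lemma lnD_le (x y : R) : 1 <= x -> 0 <= y -> ln (x + y) <= ln x + ln (1 + y).
Proof.
move=> x1 y0; have x0 : 0 < x by exact: lt_le_trans x1.
have y1 : 0 < 1 + y by exact: ltr_pwDl.
rewrite -lnM ?posrE// ler_ln ?posrE ?mulr_gt0 ?ltr_pwDl//.
by rewrite mulrDr mulr1 lerD2l ler_peMl.
Qed.

(** Only lengths beyond the cutoff [K] count: the mean becomes small for large [K]. *)
Definition log_tail (K : R) (t : G) : R := if L t <= K then 0 else ln (1 + L t).

Lemma log_tail_ge0 K t : 0 <= log_tail K t.
Proof.
by rewrite /log_tail; case: ifP => // _; rewrite ln_ge0// lerDl length_ge0.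
Qed.

(* A factor t with L t <= K costs a shift of b by K; the others are charged to the tail. *)
Lemma gmean_log_conv_pow_le (K tau : R) n (b : R) : 0 <= K -> 0 <= tau -> 0 <= b ->
  (gmean mu (log_tail K) <= tau%:E)%E ->
  (gmean (conv_pow mu n) (fun s => ln (1 + b + L s)) <=
   (ln (1 + b + n%:R * K) + n%:R * tau)%:E)%E.
Proof.
move=> K0 tau0 + tailK.
have Fge0 (c : R) s : 0 <= c -> 0 <= ln (1 + c + L s).
  by move=> c0; rewrite ln_ge0// -addrA lerDl addr_ge0// length_ge0.
(* The shift [b] must vary in the induction: the hypothesis is used at [b + K]. *)
elim: n b => [|n IH] b b0.
  rewrite gmean_conv_pow0; last by move=> s; exact: Fge0.
  by case: lenL => -> _ _; rewrite !mul0r !addr0.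
have pP := conv_pow_prob n muP.
have p0 s : 0 <= conv_pow mu n s by exact: prob_ge0.
have mu0 s : 0 <= mu s by exact: prob_ge0.
have bK : 0 <= b + K by exact: addr_ge0.
rewrite /= gmean_conv//; last by move=> s; exact: Fge0.
apply: (@le_trans _ _
    (gmean (conv_pow mu n) (fun s => ln (1 + (b + K) + L s) + tau))).
  apply: le_esum => s _; rewrite EFinM; apply: lee_wpmul2l; first by rewrite lee_fin.
  apply: (@le_trans _ _
      (gmean mu (fun t => ln (1 + (b + K) + L s) + log_tail K t))); last first.
    rewrite gmeanD//; [|by move=> _; exact: Fge0|exact: log_tail_ge0].
    by rewrite gmean_cst ?Fge0// EFinD; exact: leeD2l.
  apply: le_gmean => // t _; case: lenL => _ _ LM.
  have Ls := length_ge0 s; have Lt := length_ge0 t.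
  have Lst := length_ge0 (s * t)%g.
  rewrite /log_tail; case: ifPn => [LtK|_].
    rewrite addr0 ler_ln ?posrE; last 2 first.
    - by rewrite -addrA ltr_pwDl// addr_ge0.
    - by rewrite -addrA ltr_pwDl// addr_ge0.
    by have := LM s t; lra.
  apply: (@le_trans _ _ (ln (1 + (b + K) + L s + L t))).
    rewrite ler_ln ?posrE; last 2 first.
    - by rewrite -addrA ltr_pwDl// addr_ge0.
    - by rewrite -!addrA ltr_pwDl// !addr_ge0.
    by have := LM s t; lra.
  by apply: lnD_le => //; lra.
rewrite gmeanD//; last by move=> s; exact: Fge0.
rewrite gmean_cst//; apply: (le_trans (leeD2r _ (IH _ bK))).
rewrite -EFinD lee_fin -natr1.
have -> : 1 + (b + K) + n%:R * K = 1 + b + (n%:R + 1) * K by ring.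
by lra.
Qed.

(** A finite set carries the log-moment up to [eps]; a cutoff above all lengths in that set leaves
    only the remainder in the tail. *)
Lemma log_tail_small (eps : R) : finite_log_moment mu L -> 0 < eps ->
  exists2 K, 0 <= K & (gmean mu (log_tail K) <= eps%:E)%E.
Proof.
move=> fin eps0; pose f s := (mu s * ln (1 + L s))%:E.
have f0 s : (0 <= f s)%E.
  rewrite lee_fin mulr_ge0 ?(prob_ge0 _ muP)// ln_ge0// lerDl.
  exact: length_ge0.
have Sfin : (\esum_(s in setT) f s)%E \is a fin_num.
  by rewrite ge0_fin_numE//; apply: esum_ge0.
have [_ [X [finX _] <-] ltX] := ub_ereal_sup_adherent eps0 Sfin.
have LX t : X t -> L t <= \sum_(s \in X) L s.
  move=> Xt; rewrite (fsbigD1 t)//= lerDl.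
  by rewrite fsumr_ge0// => s _; exact: length_ge0.
(* Lengths are nonnegative, so their sum over [X] bounds each of them. *)
exists (\sum_(s \in X) L s).
  by rewrite fsumr_ge0// => s _; exact: length_ge0.
apply: (@le_trans _ _ (\esum_(s in setT `&` ~` X) f s)%E).
  rewrite setTI esum_mkcond; apply: le_esum => s _.
  rewrite in_setC; case: (boolP (s \in X)) => [|_] /=.
    by rewrite inE => /LX sX; rewrite /log_tail sX mulr0.
  rewrite lee_fin ler_wpM2l ?(prob_ge0 _ muP)// /log_tail.
  by case: ifP => // _; rewrite ln_ge0// lerDl length_ge0.
move: Sfin ltX; rewrite -/(esum setT f) (esumID X setT f)// setTI.
rewrite fin_numD esum_fset// => /andP[fin1 fin2].
move: fin1 fin2; case: (\sum_(_ \in _) _)%E => // x _.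
case: (esum _ _) => // y _; rewrite -!EFinD lte_fin lee_fin; lra.
Qed.

Lemma ln_affine_le (K eps : R) : 0 <= K -> 0 < eps ->
  exists2 C, 0 <= C & forall n : nat, ln (1 + n%:R * K) <= eps * n%:R + C.
Proof.
move=> K0 eps0; pose c := K + 1.
have c0 : 0 < c by rewrite /c ltr_wpDl.
exists `|eps / c + ln (c / eps)| => // n.
(* Rescaling by [eps / c] before applying [ln x < x] makes the slope in [n] equal to [eps]; the
   compensating factor [c / eps] only adds a constant. *)
apply: (@le_trans _ _ (ln ((1 + n%:R * c) * (eps / c) * (c / eps)))).
  have -> : (1 + n%:R * c) * (eps / c) * (c / eps) = 1 + n%:R * c.
    by field; rewrite !gt_eqF.
  rewrite ler_ln ?posrE ?ltr_pwDl ?mulr_ge0// ?(ltW c0)//.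
  by rewrite lerD2l ler_wpM2l// /c lerDl.
have pos : 0 < (1 + n%:R * c) * (eps / c).
  by rewrite mulr_gt0 ?divr_gt0// ltr_pwDl// mulr_ge0// ltW.
rewrite lnM ?posrE ?divr_gt0//.
apply: (@le_trans _ _ ((1 + n%:R * c) * (eps / c) + ln (c / eps))).
  by rewrite lerD2r ltW// ln_sublinear.
have -> : (1 + n%:R * c) * (eps / c) = eps * n%:R + eps / c.
  by field; rewrite gt_eqF.
by rewrite -addrA lerD2l ler_norm.
Qed.

(** Half of [eps] pays for the tail at each of the [n] factors, the other half for the growth of
    [ln (1 + n * K)]. *)
Lemma log_moment_sublinear (eps : R) : finite_log_moment mu L -> 0 < eps ->
  exists2 C, 0 <= C & forall n,
    (gmean (conv_pow mu n) (fun s => ln (1 + L s)) <= (eps * n%:R + C)%:E)%E.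
Proof.
move=> fin eps0; have e2 : 0 < eps / 2 by rewrite divr_gt0.
have [K K0 tailK] := log_tail_small fin e2.
have [C C0 lnC] := ln_affine_le K0 e2.
exists C => // n.
have := gmean_log_conv_pow_le n K0 (ltW e2) (lexx 0) tailK.
rewrite addr0 => /le_trans -> //; rewrite lee_fin.
by have := lnC n; lra.
Qed.

End LogMoment.

(** * Gibbs' inequality and a criterion for normalised limits *)

Lemma shannon_entropy_le_cross (R : realType) (G : CountGroup.type) (p q : G -> R) :
  is_prob_on_group p -> (forall s, 0 < q s <= 1) ->
  (shannon_entropy p <= gmean p (fun s => - ln (q s))%R + \esum_(s in setT) (q s)%:E)%E.
Proof.
move=> pP q01; have p0 s : 0 <= p s by exact: prob_ge0.
have q0 s : 0 < q s by have /andP[] := q01 s.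
(* The bound [q <= 1] makes the cross-entropy terms nonnegative, so the two sums can be merged and
   compared termwise. *)
rewrite -esumD; last 2 first.
- move=> s _; rewrite lee_fin mulr_ge0// oppr_ge0 ln_le0//.
  by have /andP[] := q01 s.
- by move=> s _; rewrite lee_fin ltW.
apply: le_esum => s _; rewrite -EFinD lee_fin.
have := p0 s; rewrite le_eqVlt => /predU1P[<-|ps].
  by rewrite !mul0r oppr0 add0r ltW.
have r0 : 0 < q s / p s by rewrite divr_gt0.
(* Multiplied by [p s], this gives [p ln q - p ln p <= q - p]. As [q] need not have mass one, its
   total mass stays in the bound. *)
have le1 : ln (q s / p s) <= q s / p s - 1.
  have := @le_ln1Dx _ (q s / p s - 1); rewrite [1 + _]addrC subrK; apply.
  by rewrite ltrBrDr addrC subrr.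
rewrite ln_div ?posrE// -(ler_pM2l ps) in le1; move: le1.
have -> : p s * (q s / p s - 1) = q s - p s by field; rewrite gt_eqF.
by rewrite mulrBr; lra.
Qed.

(** An error [eps * n + C], with [C] depending on [eps], is [o(n)]: use it at [eps / 2] and wait
    until [C <= (eps / 2) * n]. *)
Lemma cvg_inv_nat_mul (R : realType) (u : nat -> \bar R) (h : R) :
  (forall eps : R, 0 < eps -> exists2 C, 0 <= C & forall n,
     ((n%:R * h - (eps * n%:R + C))%:E <= u n <= (n%:R * h + (eps * n%:R + C))%:E)%E) ->
  (fun n => ((n%:R^-1)%:E * u n)%E) @ \oo --> h%:E.
Proof.
move=> hu.
have ufin n : u n \is a fin_num.
  have [C _ /(_ n)/andP[l r]] := hu 1 ltr01.
  rewrite fin_real//; apply/andP; split.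
    by apply: lt_le_trans l; rewrite ltNyr.
  by apply: le_lt_trans r _; rewrite ltry.
apply: (@cvg_trans _ ((fun n => (n%:R^-1 * fine (u n))%:E) @ \oo)).
  by apply: near_eq_cvg; near=> n; rewrite EFinM fineK.
apply: cvg_EFin; first exact: nearW.
apply/cvgrPdist_le => /= eps eps0.
have e2 : 0 < eps / 2 by rewrite divr_gt0.
have [C C0 hC] := hu _ e2.
near=> n.
have n0 : 0 < n%:R :> R.
  by rewrite ltr0n; near: n; exact: nbhs_infty_gt.
have nC : C / (eps / 2) <= n%:R by near: n; exact: nbhs_infty_ger.
have /andP[] := hC n; rewrite -[in leRHS](fineK (ufin n)) lee_fin => l.
rewrite -(fineK (ufin n)) lee_fin => r; rewrite fineK//.
rewrite ler_pdivrMr// in nC; rewrite ler_distlC.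
apply/andP; split.
  by rewrite ler_pdivlMl//; lra.
by rewrite ler_pdivrMl//; lra.
Unshelve. all: by end_near.
Qed.

(** * Almost-everywhere comparison and densities *)

Section AlmostEverywhere.
Context {R : realType} {dX : measure_display} {X : measurableType dX}.
Variable xi : probability X R.
Implicit Types f g : X -> R.

Lemma ae_bounded_integrable f (M : R) : measurable_fun setT f ->
  {ae xi, forall x, `|f x| <= M} -> xi.-integrable setT (EFin \o f).
Proof.
move=> mf fM; apply/integrableP; split; first exact/measurable_EFinP.
apply: (@le_lt_trans _ _ (\int[xi]_x (cst `|M|%:E) x)%E); last first.
  by rewrite integral_cst// [X in (_ * X)%E]probability_setT mule1 ltry.
apply: ae_ge0_le_integral => //.
- by do 2 apply: measurableT_comp => //.
- by move=> x _; rewrite lee_fin.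
- apply: filterS fM => x fxM _ /=; rewrite lee_fin.
  exact: le_trans fxM (ler_norm _).
Qed.

Lemma ae_eq_Rintegral f g : measurable_fun setT f -> measurable_fun setT g ->
  {ae xi, forall x, f x = g x} -> \int[xi]_x f x = \int[xi]_x g x.
Proof.
move=> mf mg fg; congr fine; apply: ae_eq_integral => //; try exact/measurable_EFinP.
by apply: filterS fg => x /= ->.
Qed.

Lemma ae_le_Rintegral f g : xi.-integrable setT (EFin \o f) ->
  xi.-integrable setT (EFin \o g) -> {ae xi, forall x, f x <= g x} ->
  \int[xi]_x f x <= \int[xi]_x g x.
Proof.
move=> intf intg fg; rewrite -subr_ge0 -RintegralB//.
have mf : measurable_fun setT f by apply/measurable_EFinP; exact: measurable_int intf.
have mg : measurable_fun setT g by apply/measurable_EFinP; exact: measurable_int intg.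
(* The absolute value is nonnegative everywhere, not just almost everywhere. *)
rewrite (@ae_eq_Rintegral _ (fun x => `|g x - f x|)).
- by apply: Rintegral_ge0.
- exact: measurable_funB.
- by apply: measurableT_comp => //; exact: measurable_funB.
- by apply: filterS fg => x fgx; rewrite ger0_norm// subr_ge0.
Qed.

Lemma Rintegral_prob_cst (c : R) : \int[xi]_x c = c.
Proof. by rewrite Rintegral_cst// [X in fine X]probability_setT mulr1. Qed.

Lemma integrable_prob_cst (c : R) : xi.-integrable setT (EFin \o cst c).
Proof. exact: finite_measure_integrable_cst. Qed.

(** Testing the hypothesis on the set where [g < f] forces the integral of [f - g] there to vanish,
    so that set is null. *)
Lemma ae_le_of_integral_le f g : measurable_fun setT f -> measurable_fun setT g ->
  xi.-integrable setT (EFin \o f) -> xi.-integrable setT (EFin \o g) ->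
  (forall A, measurable A ->
    (\int[xi]_(x in A) (f x)%:E <= \int[xi]_(x in A) (g x)%:E)%E) ->
  {ae xi, forall x, f x <= g x}.
Proof.
move=> mf mg intf intg le_int; pose B := [set x | g x < f x].
have mB : measurable B.
  by rewrite /B -[X in measurable X]setTI; exact: measurable_fun_ltr.
have intfB : xi.-integrable B (EFin \o f) by exact: integrableS intf.
have intgB : xi.-integrable B (EFin \o g) by exact: integrableS intg.
have mfgB : measurable_fun B (fun x => (f x - g x)%:E).
  by apply/measurable_EFinP; apply: measurable_funTS; exact: measurable_funB.
have : (\int[xi]_(x in B) `|(f x - g x)%:E| = 0)%E.
  transitivity (\int[xi]_(x in B) ((f x)%:E - (g x)%:E))%E.
    apply: eq_integral => x; rewrite inE /B /= => gf.
    by rewrite ger0_norm ?EFinB// subr_ge0 ltW.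
  apply/eqP; rewrite eq_le; apply/andP; split.
    rewrite integralB// sube_le0; exact: le_int.
  by apply: integral_ge0 => x; rewrite /B /= => gf; rewrite -EFinB lee_fin subr_ge0 ltW.
move/(ae_eq_integral_abs xi mB mfgB); apply: filterS => x fgB.
rewrite leNgt; apply/negP => gf; have := fgB gf.
by move=> -[/eqP]; rewrite subr_eq0 gt_eqF.
Qed.

(** The change of variables holds for the chosen Radon-Nikodym derivative of [nu]; [r] has the same
    integrals, hence agrees with it almost everywhere. *)
Lemma ge0_integral_density (nu : {finite_measure set X -> \bar R}) (r : X -> R)
    (g : X -> \bar R) (A : set X) :
  measurable_fun setT r -> (forall x, 0 <= r x) ->
  (forall B, measurable B -> nu B = (\int[xi]_(x in B) (r x)%:E)%E) ->
  measurable A -> measurable_fun setT g -> (forall x, 0 <= g x)%E ->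
  (\int[nu]_(x in A) g x = \int[xi]_(x in A) (g x * (r x)%:E))%E.
Proof.
move=> mr r0 nuE mA mg g0.
have nuxi : nu `<< xi.
  apply/null_content_dominatesP => B mB xiB0; rewrite nuE//.
  apply: null_set_integral => //.
  exact/measurable_EFinP/measurable_funTS.
have RNr : ae_eq xi A (Radon_Nikodym_SigmaFinite.f nu xi) (EFin \o r).
  apply: integral_ae_eq => //.
  - apply: (@integrableS _ _ _ _ setT) => //.
    exact: Radon_Nikodym_SigmaFinite.f_integrable.
  - exact/measurable_EFinP/measurable_funTS.
  - by move=> B BA mB; rewrite -Radon_Nikodym_SigmaFinite.f_integral// nuE.
rewrite -(Radon_Nikodym_SigmaFinite.change_of_variables nuxi)//; last first.
  exact: measurable_funTS.
apply: ae_eq_integral => //.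
- apply: emeasurable_funM; first exact: measurable_funTS.
  apply: measurable_funTS.
  exact: measurable_int (Radon_Nikodym_SigmaFinite.f_integrable nuxi).
- apply: emeasurable_funM; first exact: measurable_funTS.
  exact/measurable_EFinP/measurable_funTS.
- exact: ae_eqe_mul2l.
Qed.

End AlmostEverywhere.

(** Passes from a sum over a countable type to a series over its integer codes, with [0] at integers
    that encode nothing, so that series of measures can be used. *)
Lemma nneseries_pickle (R : realType) (T : countType) (f : T -> \bar R) :
  (forall t, 0 <= f t)%E ->
  (\sum_(n <oo) oapp f 0%E (pickle_inv n) = \esum_(t in setT) f t)%E.
Proof.
move=> f0; rewrite nneseries_esumT; last by move=> n; case: (pickle_inv n).
have -> : (\esum_(t in setT) f t =
    \esum_(t in [set: T]) oapp f 0%E (pickle_inv (pickle t)))%E.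
  by apply: eq_esum => t _; rewrite pickleK_inv.
rewrite -(@esum_image R T nat setT pickle (fun n => oapp f 0%E (pickle_inv n))); last first.
  by move=> x y _ _; exact: (pcan_inj pickleK_inv).
rewrite [RHS]esum_mkcond; apply: eq_esum => n _.
case: ifPn => //; rewrite notin_setE => nT.
have := @pickle_invK T n; case: (pickle_inv n) => //= t tn.
by exfalso; apply: nT; exists t.
Qed.

(** * The Radon-Nikodym cocycle and stationary measures *)

Section NonSingularAction.
Context {R : realType} {G : CountGroup.type}.
Context {dX : measure_display} {X : measurableType dX}.
Variables (xi : probability X R) (a : G -> X -> X) (rho : G -> X -> R).
Hypotheses (actP : measurable_action a) (nsP : non_singular a xi).
Hypothesis rhoP : is_RN_cocycle a xi rho.

Lemma measurable_act t : measurable_fun setT (a t).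
Proof. by case: actP. Qed.

(** Needed to form the push-forward [distribution xi (a t)]. *)
HB.instance Definition _ t := isMeasurableFun.Build _ _ _ _ (a t) (measurable_act t).

Lemma act_invK t x : a t^-1%g (a t x) = x.
Proof. by case: actP => a1 aM _; rewrite -aM mulVg a1. Qed.

Lemma actK_inv t x : a t (a t^-1%g x) = x.
Proof. by case: actP => a1 aM _; rewrite -aM mulgV a1. Qed.

Lemma measurable_rho s : measurable_fun setT (rho s).
Proof. by have [] := rhoP s. Qed.

Lemma rho_ge0 s x : 0 <= rho s x.
Proof. by have [] := rhoP s. Qed.

Lemma measurable_preimage_act t A : measurable A -> measurable (a t @^-1` A).
Proof. by move=> mA; rewrite -[X in measurable X]setTI; exact: measurable_act. Qed.

(** Non-singularity enters here: preimages of null sets are null. *)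
Lemma ae_act t (P : X -> Prop) : {ae xi, forall x, P x} -> {ae xi, forall x, P (a t x)}.
Proof.
move=> [N [mN N0 PN]]; exists (a t @^-1` N); split.
- exact: measurable_preimage_act.
- exact/(nsP t mN).
- by move=> x /= nP; apply: PN.
Qed.

(** [rho t] is the density of the push-forward of [xi] under [a t^-1]. *)
Lemma integral_rho t (g : X -> \bar R) A : measurable A ->
  measurable_fun setT g -> (forall x, 0 <= g x)%E ->
  (\int[xi]_(x in A) (g x * (rho t x)%:E) =
   \int[xi]_(x in a t^-1%g @^-1` A) g (a t^-1%g x))%E.
Proof.
move=> mA mg g0; have [mr r0 rE] := rhoP t.
rewrite -(@ge0_integral_density _ _ _ xi (distribution xi (a t^-1%g)))//.
by rewrite ge0_integral_pushforward//; exact: measurable_funTS.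
Qed.

Lemma integrable_rho s : xi.-integrable setT (EFin \o rho s).
Proof.
apply/integrableP; split; first exact/measurable_EFinP/measurable_rho.
under eq_integral do rewrite /= ger0_norm ?rho_ge0//.
by have [_ _ <-//] := rhoP s; rewrite preimage_setT probability_setT ltry.
Qed.

(** Both sides are densities of the same measure: integrating the product over [A] and substituting
    gives the measure of the preimage of [A] under [a t^-1] composed with [a s^-1]. *)
Lemma rho_cocycle s t :
  {ae xi, forall x, rho (s * t)%g x = rho s (a t x) * rho t x}.
Proof.
have mst : measurable_fun setT (fun x => rho s (a t x)).
  exact: measurableT_comp (measurable_rho s) (measurable_act t).
suff : ae_eq xi setT (EFin \o rho (s * t)%g)
    (fun x => ((rho s (a t x))%:E * (rho t x)%:E)%E).
  by apply: filterS => x /(_ I) [].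
apply: integral_ae_eq => //.
- exact: integrable_rho.
- by apply: emeasurable_funM; apply/measurable_EFinP => //; exact: measurable_rho.
- move=> A _ mA; have [_ _ <-//] := rhoP (s * t)%g.
  rewrite integral_rho//; last 2 first.
  + exact/measurable_EFinP.
  + by move=> x; rewrite lee_fin rho_ge0.
  under eq_integral do rewrite actK_inv.
  have [_ _ <-//] := rhoP s; last exact: measurable_preimage_act.
  congr (xi _); apply/seteqP; case: actP => _ aM _.
  by split => x /=; rewrite invgM aM.
Qed.

Section Stationary.
Variable p : G -> R.
Hypotheses (pP : is_prob_on_group p) (pst : stationary p a xi).

Lemma stationary_le s A : measurable A -> ((p s)%:E * xi (a s @^-1` A) <= xi A)%E.
Proof.
move=> mA; rewrite -[leRHS]pst//.
apply: (@le_term_esum R G (fun s => (p s)%:E * xi (a s @^-1` A))%E) => t.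
by rewrite mule_ge0// lee_fin; exact: prob_ge0.
Qed.

Lemma ae_rho_ge s : {ae xi, forall x, p s <= rho s x}.
Proof.
apply: (@ae_le_of_integral_le _ _ _ xi (cst (p s))) => //.
- exact: measurable_rho.
- exact: integrable_prob_cst.
- exact: integrable_rho.
- move=> A mA; rewrite [leLHS](integral_cst xi mA (p s)%:E).
  have [_ _ <-//] := rhoP s.
  (* The set tested is the translate of [A] whose preimage under [a s] is [A] itself. *)
  have := stationary_le s (measurable_preimage_act s^-1%g mA).
  congr (_ * xi _ <= _)%E; apply/seteqP.
  by split => x /=; rewrite act_invK.
Qed.

(** Here the term of index [s^-1] in the stationarity sum is kept. The product form also covers
    [p s^-1 = 0]. *)
Lemma ae_rho_le s : {ae xi, forall x, p s^-1%g * rho s x <= 1}.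
Proof.
have pr : xi.-integrable setT (EFin \o (fun x => p s^-1%g * rho s x)).
  exact: (integrableZl measurableT (p s^-1%g) (integrable_rho s)).
apply: (@ae_le_of_integral_le _ _ _ xi _ (cst 1)) => //.
- by apply: measurable_funM => //; exact: measurable_rho.
- exact: integrable_prob_cst.
- move=> A mA; rewrite [leRHS](integral_cst xi mA 1%E) mul1e.
  under eq_integral do rewrite EFinM.
  rewrite integralZl//; last exact: integrableS (integrable_rho s).
  have [_ _ <-//] := rhoP s; exact: stationary_le.
Qed.

(** Stationarity says that [xi] is the countable sum of the push-forwards under [a t] scaled by
    [p t]; integration distributes over that series. *)
Lemma stationary_integral (g : X -> \bar R) : measurable_fun setT g ->
  (forall x, 0 <= g x)%E ->
  (\esum_(t in setT) ((p t)%:E * \int[xi]_x g (a t x)) = \int[xi]_x g x)%E.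
Proof.
move=> mg g0.
pose pn t : {nonneg R} := NngNum (prob_ge0 t pP).
pose m_ (n : nat) : {measure set X -> \bar R} :=
  if @pickle_inv G n is Some t then mscale (pn t) (distribution xi (a t)) else mzero.
have mA A : measurable A -> xi A = mseries m_ 0 A.
  move=> mA; rewrite -pst// -nneseries_pickle; last first.
    by move=> t; rewrite mule_ge0// lee_fin; exact: prob_ge0.
  by apply: eq_eseriesr => n _; rewrite /m_; case: (pickle_inv n).
rewrite -[RHS](@eq_measure_integral _ _ _ _ xi (mseries m_ 0)); last first.
  by move=> A mA' _; exact/esym/mA.
rewrite ge0_integral_measure_series// -nneseries_pickle; last first.
  move=> t; rewrite mule_ge0 ?lee_fin ?(prob_ge0 _ pP)//.
  by apply: integral_ge0.
apply: eq_eseriesr => n _; rewrite /m_; case: (pickle_inv n) => [t|] /=; last first.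
  by rewrite integral_measure_zero.
by rewrite ge0_integral_mscale//= ge0_integral_pushforward.
Qed.

End Stationary.

Lemma stationary_conv (nu mu : G -> R) : is_prob_on_group nu -> is_prob_on_group mu ->
  stationary nu a xi -> stationary mu a xi -> stationary (Defs.conv nu mu) a xi.
Proof.
move=> nuP muP nust must A mA.
pose F s := fine (xi (a s @^-1` A)).
have FE s : (F s)%:E = xi (a s @^-1` A).
  by rewrite fineK// fin_num_measure//; exact: measurable_preimage_act.
transitivity (gmean (Defs.conv nu mu) F).
  by apply: eq_esum => s _; rewrite EFinM FE.
rewrite gmean_conv//; last by move=> s; rewrite fine_ge0.
(* Stationarity is used twice: for [nu] on [A], then for [mu] on the preimage of [A] under [a s]. *)
rewrite -[RHS]nust//; apply: eq_esum => s _; congr (_ * _)%E.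
rewrite -[RHS]must//; last exact: measurable_preimage_act.
apply: eq_esum => t _; rewrite EFinM FE; congr (_ * xi _)%E.
by apply/seteqP; case: actP => _ aM _; split => x /=; rewrite aM.
Qed.

Lemma stationary_conv_pow (mu : G -> R) n : is_prob_on_group mu ->
  stationary mu a xi -> stationary (conv_pow mu n) a xi.
Proof.
move=> muP must; elim: n => [|n IH].
  move=> A mA; have -> : xi A = (fine (xi (a 1%g @^-1` A)))%:E.
    rewrite fineK ?fin_num_measure//; last exact: measurable_preimage_act.
    by congr (xi _); apply/seteqP; case: actP => a1 _ _; split => x /=; rewrite a1.
  rewrite -(@gmean_conv_pow0 _ _ mu (fun s => fine (xi (a s @^-1` A)))); last first.
    by move=> s; rewrite fine_ge0.
  apply: eq_esum => s _; rewrite [in RHS]EFinM fineK// fin_num_measure//.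
  exact: measurable_preimage_act.
by apply: stationary_conv => //; exact: conv_pow_prob.
Qed.

End NonSingularAction.

(** * Additivity of the Furstenberg entropy and its comparison with Shannon entropy *)

Section FurstenbergEntropy.
Context {R : realType} {G : CountGroup.type}.
Context {dX : measure_display} {X : measurableType dX}.
Variables (xi : probability X R) (a : G -> X -> X) (rho : G -> X -> R) (mu : G -> R).
Hypotheses (actP : measurable_action a) (nsP : non_singular a xi).
Hypotheses (rhoP : is_RN_cocycle a xi rho).
Hypotheses (muP : is_prob_on_group mu) (muND : non_degenerate mu).
Hypothesis must : stationary mu a xi.

(* Non-degeneracy makes every cocycle value essentially bounded above and away from 0. *)
Lemma rho_bounds s : exists2 c : R, 0 < c &
  exists C : R, {ae xi, forall x, c <= rho s x <= C}.
Proof.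
have [n ns] := conv_pow_gt0 s muP muND.
have [k ks] := conv_pow_gt0 s^-1%g muP muND.
(* The mass of [s] in one power bounds [rho s] from below, the inverse mass of [s^-1] in another
   from above. *)
exists (conv_pow mu n s) => //; exists (conv_pow mu k s^-1%g)^-1.
have st j := stationary_conv_pow actP j muP must.
have ge := ae_rho_ge actP rhoP (conv_pow_prob n muP) (st n) s.
have le := ae_rho_le rhoP (conv_pow_prob k muP) (st k) s.
apply: filterS2 ge le => x -> /=.
by rewrite -ler_pdivlMl// mulr1.
Qed.

Lemma measurable_ln_rho s : measurable_fun setT (fun x => - ln (rho s x)).
Proof.
apply: measurableT_comp => //; apply: measurableT_comp => //.
exact: measurable_rho.
Qed.

Lemma measurable_sqrt_rho s : measurable_fun setT (fun x => Num.sqrt (rho s x)).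
Proof.
apply: (@measurableT_comp _ _ _ _ _ _ (@Num.sqrt R)); last exact: measurable_rho.
by apply: continuous_measurable_fun; exact: sqrt_continuous.
Qed.

Lemma ae_rho_gt0 s : {ae xi, forall x, 0 < rho s x}.
Proof.
have [c c0 [C cC]] := rho_bounds s; apply: filterS cC => x /andP[cx _].
exact: lt_le_trans cx.
Qed.

Lemma ln_rho_bounded s : exists2 M : R, 0 <= M &
  {ae xi, forall x, `|- ln (rho s x)| <= M}.
Proof.
have [c c0 [C cC]] := rho_bounds s; exists (`|ln c| + `|ln C|).
  by rewrite addr_ge0.
apply: filterS cC => x /andP[cx xC]; have x0 := lt_le_trans c0 cx.
have C0 := lt_le_trans x0 xC.
rewrite -ler_ln ?posrE// in cx; rewrite -ler_ln ?posrE// in xC.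
rewrite normrN ler_norml; apply/andP; split.
  have := lerNnormlW (lexx `|ln c|); have := normr_ge0 (ln C); lra.
have := ler_norm (ln C); have := normr_ge0 (ln c); lra.
Qed.

Lemma integrable_ln_rho s : xi.-integrable setT (EFin \o (fun x => - ln (rho s x))).
Proof.
have [M _ sM] := ln_rho_bounded s.
exact: ae_bounded_integrable (measurable_ln_rho s) sM.
Qed.

Lemma integrable_sqrt_rho s :
  xi.-integrable setT (EFin \o (fun x => Num.sqrt (rho s x))).
Proof.
have [c c0 [C cC]] := rho_bounds s.
apply: (@ae_bounded_integrable _ _ _ xi _ (Num.sqrt C)).
  exact: measurable_sqrt_rho.
apply: filterS cC => x /andP[_ xC].
by rewrite ger0_norm ?sqrtr_ge0// ler_wsqrtr.
Qed.

Lemma XiE s : Xi xi rho s = \int[xi]_x Num.sqrt (rho s x).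
Proof. by []. Qed.

Lemma Rintegral_rho s : \int[xi]_x rho s x = 1.
Proof.
rewrite /Rintegral; have [_ _ <-//] := rhoP s.
by rewrite preimage_setT probability_setT.
Qed.

Lemma Xi_gt0 s : 0 < Xi xi rho s.
Proof.
have [c c0 [C cC]] := rho_bounds s.
apply: (@lt_le_trans _ _ (Num.sqrt c)); first by rewrite sqrtr_gt0.
rewrite XiE -[leLHS](Rintegral_prob_cst xi); apply: ae_le_Rintegral.
- exact: integrable_prob_cst.
- exact: integrable_sqrt_rho.
- by apply: filterS cC => x /andP[cx _]; rewrite ler_wsqrtr.
Qed.

(** Integrate [sqrt r <= (1 + r) / 2], using that [rho s] has mean one. *)
Lemma Xi_le1 s : Xi xi rho s <= 1.
Proof.
have int1 := integrable_prob_cst xi 1.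
have intD : xi.-integrable setT (EFin \o (fun x => 1 + rho s x)).
  exact: (integrableD measurableT int1 (integrable_rho rhoP s)).
have int2 : xi.-integrable setT (EFin \o (fun x => 2^-1 * (1 + rho s x))).
  exact: (integrableZl measurableT 2^-1 intD).
have -> : 1 = \int[xi]_x (2^-1 * (1 + rho s x)) :> R.
  rewrite RintegralZl// RintegralD//; last exact: integrable_rho.
  by rewrite Rintegral_prob_cst Rintegral_rho mulVf.
rewrite XiE; apply: ae_le_Rintegral => //; first exact: integrable_sqrt_rho.
apply: aeW => x; have r0 := rho_ge0 rhoP s x.
have := sqr_ge0 (Num.sqrt (rho s x) - 1); have := sqr_sqrtr r0.
by move: (Num.sqrt _) => y; nra.
Qed.

(** The quantity [I(s)] of the overview: the relative entropy of [xi] with respect to [s^-1 xi]. *)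
Definition log_energy s : R := \int[xi]_x - ln (rho s x).

(** Jensen's inequality through the tangent line of [ln] at the mean [m] of [sqrt rho]: the linear
    term [y / m - 1] integrates to zero. *)
Lemma neg_ln_Xi_le s : - 2 * ln (Xi xi rho s) <= log_energy s.
Proof.
have m0 := Xi_gt0 s; set m := Xi xi rho s in m0 *.
pose k : R := - 2 * ln m + 2.
have intq : xi.-integrable setT (EFin \o (fun x => 2 / m * Num.sqrt (rho s x))).
  exact: (integrableZl measurableT (2 / m) (integrable_sqrt_rho s)).
have intk := integrable_prob_cst xi k.
have -> : - 2 * ln m = \int[xi]_x (k - 2 / m * Num.sqrt (rho s x)).
  rewrite RintegralB// RintegralZl//; last exact: integrable_sqrt_rho.
  by rewrite Rintegral_prob_cst -XiE -/m /k; field; rewrite gt_eqF.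
apply: ae_le_Rintegral.
- exact: (integrableB measurableT intk intq).
- exact: integrable_ln_rho.
apply: filterS (ae_rho_gt0 s) => x x0.
have q0 : 0 < Num.sqrt (rho s x) by rewrite sqrtr_gt0.
rewrite -[in leRHS](sqr_sqrtr (ltW x0)) lnXn//.
move: (Num.sqrt _) q0 => y y0.
have := @le_ln1Dx _ (y / m - 1).
rewrite [1 + _]addrC subrK ltrBrDr addrC subrr divr_gt0// => /(_ isT).
rewrite ln_div ?posrE// mulr2n /k.
have -> : 2 / m * y = 2 * (y / m) by field; rewrite gt_eqF.
lra.
Qed.

Lemma log_energy_ge0 s : 0 <= log_energy s.
Proof.
apply: le_trans (neg_ln_Xi_le s); rewrite mulNr oppr_ge0 pmulr_rle0//.
by rewrite ln_le0// Xi_le1.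
Qed.

Lemma log_energyE s : (\int[xi]_x (- ln (rho s x))%:E = (log_energy s)%:E)%E.
Proof.
by rewrite fineK// integrable_fin_num//; exact: integrable_ln_rho.
Qed.

Lemma furstenberg_entropyE : furstenberg_entropy mu xi rho = gmean mu log_energy.
Proof. by apply: eq_esum => s _; rewrite log_energyE. Qed.

Lemma log_energy_le p s : is_prob_on_group p -> stationary p a xi -> 0 < p s ->
  log_energy s <= - ln (p s).
Proof.
move=> pP pst ps; rewrite -[leRHS](Rintegral_prob_cst xi).
apply: ae_le_Rintegral.
- exact: integrable_ln_rho.
- exact: integrable_prob_cst.
- apply: filterS (ae_rho_ge actP rhoP pP pst s) => x px.
  by rewrite lerN2 ler_ln ?posrE//; exact: lt_le_trans px.
Qed.

Lemma gmean_log_energy_le_entropy p : is_prob_on_group p -> stationary p a xi ->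
  (gmean p log_energy <= shannon_entropy p)%E.
Proof.
move=> pP pst; apply: (@le_trans _ _ (gmean p (fun s => - ln (p s)))).
  apply: le_gmean => [s|s ps]; first exact: prob_ge0.
  exact: log_energy_le.
by apply: le_esum => s _; rewrite mulrN.
Qed.

Lemma integrable_ln_rho_act s t :
  xi.-integrable setT (EFin \o (fun x => - ln (rho s (a t x)))).
Proof.
have [M _ sM] := ln_rho_bounded s.
apply: (@ae_bounded_integrable _ _ _ xi _ M).
  exact: measurableT_comp (measurable_ln_rho s) (measurable_act actP t).
exact: (ae_act actP nsP t sM).
Qed.

Lemma log_energyM s t :
  log_energy (s * t)%g = \int[xi]_x (- ln (rho s (a t x))) + log_energy t.
Proof.
rewrite /log_energy -RintegralD//; last 2 first.
- exact: integrable_ln_rho_act.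
- exact: integrable_ln_rho.
apply: ae_eq_Rintegral.
- exact: measurable_ln_rho.
- apply: measurable_funD; last exact: measurable_ln_rho.
  exact: measurableT_comp (measurable_ln_rho s) (measurable_act actP t).
- have pos := ae_act actP nsP t (ae_rho_gt0 s).
  apply: filterS3 (rho_cocycle actP rhoP s t) pos (ae_rho_gt0 t) => x -> sx tx.
  by rewrite lnM ?posrE// opprD.
Qed.

(** The cocycle identity at the neutral element reads [I = I + I]. *)
Lemma log_energy1 : log_energy 1%g = 0.
Proof.
have := log_energyM 1%g 1%g; rewrite mulg1.
have -> : \int[xi]_x (- ln (rho 1%g (a 1%g x))) = log_energy 1%g.
  by apply: eq_Rintegral => x _; case: actP => ->.
by lra.
Qed.

(** By the cocycle identity, [I(st) - I(t)] is the integral of [- ln (rho s)] along [a t]; averaging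
    over [t], stationarity turns it into [I(s)]. *)
Lemma gmean_log_energy_translate h s : gmean mu log_energy = h%:E ->
  gmean mu (fun t => log_energy (s * t)%g) = (log_energy s + h)%:E.
Proof.
move=> hE; have mu0 t : 0 <= mu t by exact: prob_ge0.
have [M M0 sM] := ln_rho_bounded s.
(* [stationary_integral] requires nonnegativity everywhere, while [- ln (rho s x)] is at least [- M]
   only almost everywhere; hence the shift by [M] and the cut at zero. *)
pose g x := Num.max 0 (M - ln (rho s x)).
have mg : measurable_fun setT g.
  apply: measurable_maxr => //; apply: measurable_funD => //.
  exact: measurable_ln_rho.
have g0 x : 0 <= g x by rewrite le_max lexx.
have gE : {ae xi, forall x, g x = M - ln (rho s x)}.
  apply: filterS sM => x; rewrite normrN ler_norml => /andP[_ xM].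
  by apply/max_idPr; rewrite subr_ge0.
have intM := integrable_prob_cst xi M.
have gat t : (\int[xi]_x (g (a t x))%:E =
    (log_energy (s * t)%g - log_energy t + M)%:E)%E.
  have -> : log_energy (s * t)%g - log_energy t + M = \int[xi]_x g (a t x).
    rewrite log_energyM addrK addrC -[in LHS](Rintegral_prob_cst xi M).
    rewrite -RintegralD//; last exact: integrable_ln_rho_act.
    apply: ae_eq_Rintegral.
    - apply: measurable_funD => //.
      exact: measurableT_comp (measurable_ln_rho s) (measurable_act actP t).
    - exact: measurableT_comp mg (measurable_act actP t).
    - by apply: filterS (ae_act actP nsP t gE) => x ->.
  rewrite fineK// integrable_fin_num//.
  apply: (@ae_bounded_integrable _ _ _ xi _ (M + M)).
    exact: measurableT_comp mg (measurable_act actP t).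
  apply: filterS2 (ae_act actP nsP t gE) (ae_act actP nsP t sM) => x /= gx sx.
  rewrite ger0_norm// gx; rewrite normrN ler_norml in sx; lra.
have k0 t : 0 <= log_energy (s * t)%g - log_energy t + M.
  by rewrite -lee_fin -gat; apply: integral_ge0 => x _; rewrite lee_fin.
have : gmean mu (fun t => log_energy (s * t)%g - log_energy t + M) =
    (log_energy s + M)%:E.
  transitivity (\int[xi]_x (EFin \o g) x)%E.
    rewrite -(@stationary_integral _ _ _ _ xi a actP mu muP must (EFin \o g)).
    - by apply: eq_esum => t _; rewrite gat.
    - exact/measurable_EFinP.
    - by move=> x; rewrite lee_fin.
  have := gat 1%g; rewrite mulg1 log_energy1 subr0 => <-.
  by apply: eq_integral => x _; case: actP => ->.
(* Adding the mean [h] cancels the subtracted [log_energy t]; the shift [M] is then removed from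
   both finite sides. *)
move=> /(congr1 (fun z => (z + gmean mu log_energy)%E)).
rewrite -gmeanD//; last exact: log_energy_ge0.
under [X in gmean mu X]eq_fun do rewrite addrAC subrK.
rewrite gmeanD//; last by move=> t; exact: log_energy_ge0.
rewrite gmean_cst// hE -EFinD.
case: (gmean _ _) => //= r [] rM; congr (_%:E); lra.
Qed.

Lemma gmean_conv_pow_log_energy h n : gmean mu log_energy = h%:E ->
  gmean (conv_pow mu n) log_energy = (n%:R * h)%:E.
Proof.
move=> hE; have h0 : 0 <= h.
  rewrite -lee_fin -hE; apply: gmean_ge0; last exact: log_energy_ge0.
  by move=> s; exact: prob_ge0.
elim: n => [|n IH].
  by rewrite gmean_conv_pow0 ?log_energy1 ?mul0r//; exact: log_energy_ge0.
have pP := conv_pow_prob n muP.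
rewrite /= gmean_conv//; last exact: log_energy_ge0.
transitivity (gmean (conv_pow mu n) (fun s => log_energy s + h)).
  by apply: eq_esum => s _; rewrite (gmean_log_energy_translate _ hE).
rewrite gmeanD//; [|by move=> s; exact: prob_ge0|exact: log_energy_ge0].
by rewrite IH gmean_cst// -EFinD -natr1 mulrDl mul1r.
Qed.

End FurstenbergEntropy.

(** * Weighted square-summability of [Xi] from property RD *)

Section SphericalFunction.
Context {R : realType} {G : CountGroup.type}.
Context {dX : measure_display} {X : measurableType dX}.
Variables (xi : probability X R) (a : G -> X -> X) (rho : G -> X -> R).
Variables (mu L : G -> R).
Hypotheses (actP : measurable_action a) (rhoP : is_RN_cocycle a xi rho).
Hypotheses (muP : is_prob_on_group mu) (muND : non_degenerate mu).
Hypotheses (must : stationary mu a xi) (lenL : is_length_function L).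
Hypothesis weakP : weakly_contained_in_regular xi a rho.

Let omega (d : nat) (s : G) : R := (1 + L s) ^+ d.

Let omega_gt0 d s : 0 < omega d s.
Proof. by rewrite exprn_gt0// ltr_pwDl// (length_ge0 lenL). Qed.

Lemma normsq_real (r : R) : normsq (r%:C)%C = r ^+ 2.
Proof. by rewrite /normsq /= expr0n addr0. Qed.

Lemma l2sq_ge0 (g : G -> R[i]) : 0 <= l2sq g.
Proof. by apply: fsumr_ge0 => s _; rewrite addr_ge0// sqr_ge0. Qed.

(* Testing weak containment on the constant function 1 and the element
   sum_{s in F} Xi(s^-1) omega(s)^-2 s of the group algebra. *)
Lemma fsum_Xi_le d (C : R) (F : set G) :
  (forall f g : G -> R[i], fin_supp f -> fin_supp g ->
    l2sq (reg_conv f g) <= C * l2wsq L d f * l2sq g) ->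
  finite_set F ->
  \sum_(s \in F) (Xi xi rho s^-1%g ^+ 2 / omega d s ^+ 2) <= `|C|.
Proof.
move=> RD finF; set Q := (X in X <= _).
have Xi0 s : 0 < Xi xi rho s by exact: (@Xi_gt0 _ _ _ _ xi a rho mu).
(* With this weight, both the squared weighted norm of [f] and the integral of [pi(f) 1] equal
   [Q]. *)
pose w s := Xi xi rho s^-1%g / omega d s ^+ 2.
have w0 s : 0 < w s by rewrite divr_gt0// exprn_gt0.
pose f s : R[i] := if s \in F then ((w s)%:C)%C else 0.
have suppf : supp f = F.
  apply/seteqP; split => s; rewrite /supp /f /=.
    by case: ifPn => [/set_mem//|_]; rewrite eqxx.
  by move=> Fs; rewrite mem_set// eq_complex /= eqxx andbT gt_eqF.
have finf : fin_supp f by rewrite /fin_supp suppf.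
have Q0 : 0 <= Q.
  by apply: fsumr_ge0 => s _; rewrite divr_ge0// sqr_ge0.
have fQ : l2wsq L d f = Q.
  rewrite /l2wsq suppf; apply: eq_fsbigr => s Fs.
  rewrite /f Fs normsq_real /w -/(omega d s); field.
  by rewrite gt_eqF.
have norm_f (g : G -> R[i]) : fin_supp g ->
    l2sq (reg_conv f g) <= `|C| * Q * l2sq g.
  move=> fing; apply: le_trans (RD f g finf fing) _; rewrite fQ.
  by rewrite ler_wpM2r ?l2sq_ge0// ler_wpM2r// ler_norm.
pose k x := \sum_(s \in F) (w s * Num.sqrt (rho s^-1%g x)).
have k0 x : 0 <= k x.
  by apply: fsumr_ge0 => s _; rewrite mulr_ge0 ?sqrtr_ge0// ltW.
have mwr s : measurable_fun setT (fun x => w s * Num.sqrt (rho s^-1%g x)).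
  by apply: measurable_funM => //; exact: measurable_sqrt_rho.
have mk : measurable_fun setT k.
  rewrite /k; under eq_fun do rewrite fsbig_finite//.
  exact: measurable_sum.
(* The Koopman operator of [s] involves [rho s^-1], which is why [Xi] is taken at [s^-1]. *)
have kE x : koopman a rho f (fun=> 1) x = ((k x)%:C)%C.
  rewrite /koopman suppf /k !fsbig_finite//= rmorph_sum /=.
  rewrite big_seq [RHS]big_seq; apply: eq_bigr => s.
  by rewrite in_fset_set// /f => ->; rewrite mulr1 [RHS](rmorphM _ (w s)).
have int1 : L2sq xi (fun=> 1) = 1%E.
  rewrite /L2sq; under eq_integral do rewrite normsq_real expr1n.
  by rewrite (integral_cst xi measurableT 1%E) mul1e; exact: probability_setT.
have L2_1 : in_L2 xi (fun=> 1).
  by split; [exact: measurable_cst|exact: measurable_cst|rewrite int1 ltry].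
have := weakP finf norm_f L2_1; rewrite int1 mule1.
rewrite /L2sq; under eq_integral do rewrite kE normsq_real.
move=> le_k2.
have int_k : (\int[xi]_x (k x)%:E = Q%:E)%E.
  under eq_integral do rewrite -fsumEFin//.
  rewrite ge0_integral_fsum//; last 2 first.
  - by move=> s; exact/measurable_EFinP.
  - by move=> s x _; rewrite lee_fin mulr_ge0 ?sqrtr_ge0// ltW.
  rewrite -fsumEFin//; apply: eq_fsbigr => s _.
  under eq_integral do rewrite EFinM.
  rewrite integralZl//; last exact: (@integrable_sqrt_rho _ _ _ _ xi a rho mu).
  have -> : (\int[xi]_x (Num.sqrt (rho s^-1%g x))%:E = (Xi xi rho s^-1%g)%:E)%E.
    rewrite fineK// integrable_fin_num//.
    exact: (@integrable_sqrt_rho _ _ _ _ xi a rho mu).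
  by rewrite -EFinM /w; congr (_%:E); field; rewrite gt_eqF.
(* Cauchy-Schwarz in the form [(k - Q)^2 >= 0]. As [k] has integral [Q] and its square at most
   [|C| * Q], this yields [Q^2 <= |C| * Q]. *)
have le_int : ((2 * Q)%:E * \int[xi]_x (k x)%:E <=
    \int[xi]_x ((k x) ^+ 2)%:E + \int[xi]_x (cst (Q ^+ 2)%:E) x)%E.
  rewrite -ge0_integralZl//; last 3 first.
  - exact/measurable_EFinP.
  - by move=> x _; rewrite lee_fin.
  - by rewrite lee_fin mulr_ge0.
  rewrite -ge0_integralD//; last 3 first.
  - by move=> x _; rewrite lee_fin sqr_ge0.
  - by apply/measurable_EFinP; exact: measurable_funX.
  - by move=> x _; rewrite lee_fin sqr_ge0.
  apply: ge0_le_integral => //.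
  - by move=> x _; rewrite lee_fin !mulr_ge0.
  - by apply: measurable_funeM; exact/measurable_EFinP.
  - by apply: emeasurable_funD => //; apply/measurable_EFinP; exact: measurable_funX.
  - move=> x _; rewrite -EFinM -EFinD lee_fin.
    by have := sqr_ge0 (k x - Q); nra.
have cstE : (\int[xi]_x (cst (Q ^+ 2)%:E) x = (Q ^+ 2)%:E)%E.
  by rewrite integral_cst// [X in (_ * X)%E]probability_setT mule1.
rewrite int_k cstE in le_int.
have := le_trans le_int (leeD2r _ le_k2); rewrite -EFinM -EFinD lee_fin => QC.
have [->//|Qn0] := eqVneq Q 0.
have Qgt0 : 0 < Q by rewrite lt_def Qn0.
by rewrite -(ler_pM2r Qgt0); nra.
Qed.

(** The finite bounds are uniform, so they pass to the supremum; inversion turns [Xi s^-1] into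
    [Xi s], as [L] is symmetric. *)
Lemma esum_Xi_le : property_RD L -> exists d (C : R), 0 <= C /\
  (\esum_(s in setT) (Xi xi rho s ^+ 2 / omega d s ^+ 2)%:E <= C%:E)%E.
Proof.
move=> [d [C RD]]; exists d, `|C|; split => //.
rewrite (reindex_esum setT setT (fun s : G => s^-1%g)); last first.
  split => //; first by move=> x y _ _ /invg_inj.
  by move=> x _; exists x^-1%g => //; rewrite invgK.
apply: ge_ereal_sup => _ [F [finF _] <-]; rewrite fsumEFin// lee_fin.
rewrite -[leLHS](_ : \sum_(s \in F) (Xi xi rho s^-1%g ^+ 2 / omega d s ^+ 2) = _).
  exact: fsum_Xi_le.
case: lenL => _ LV _; apply: eq_fsbigr => s _.
by rewrite /omega LV.
Qed.

End SphericalFunction.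

(** * The entropy formula *)

Theorem theorem6p2 (R : realType) (G : CountGroup.type) (L : G -> R) (mu : G -> R)
    (dX : measure_display) (X : measurableType dX) (xi : probability X R)
    (a : G -> X -> X) (rho : G -> X -> R) :
  is_length_function L ->
  property_RD L ->
  is_prob_on_group mu ->
  non_degenerate mu ->
  (shannon_entropy mu < +oo)%E ->
  finite_log_moment mu L ->
  standard_borel R X ->
  measurable_action a ->
  non_singular a xi ->
  stationary mu a xi ->
  is_RN_cocycle a xi rho ->
  weakly_contained_in_regular xi a rho ->
  furstenberg_entropy mu xi rho = avez_entropy mu /\
  (fun n : nat => ((2 * n%:R^-1)%:E *
      esum setT (fun s => (conv_pow mu n s * - ln (Xi xi rho s))%:E))%E)
    @ \oo --> avez_entropy mu.
Proof.
move=> lenL RD muP muND Hfin logL _ actP nsP must rhoP weakP.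
pose I := log_energy xi rho.
have I0 s : 0 <= I s by exact: (@log_energy_ge0 _ _ _ _ xi a rho mu).
have Xi01 s : 0 < Xi xi rho s <= 1.
  by rewrite (@Xi_gt0 _ _ _ _ xi a rho mu)//= (@Xi_le1 _ _ _ _ xi a rho mu).
have lnXi s : 0 <= - ln (Xi xi rho s).
  by rewrite oppr_ge0 ln_le0//; have /andP[] := Xi01 s.
have lnL s : 0 <= ln (1 + L s) by rewrite ln_ge0// lerDl (length_ge0 lenL).
have le_entropy p : is_prob_on_group p -> stationary p a xi ->
    (gmean p I <= shannon_entropy p)%E.
  exact: (@gmean_log_energy_le_entropy _ _ _ _ xi a rho mu).
have mu0 s : 0 <= mu s by exact: prob_ge0.
(* Finite Shannon entropy of [mu] makes the Furstenberg entropy a real number. *)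
have [h hE] : exists h, gmean mu I = h%:E.
  exists (fine (gmean mu I)); rewrite fineK// ge0_fin_numE; last exact: gmean_ge0.
  exact: le_lt_trans (le_entropy _ muP must) Hfin.
have [d [C [C0 leC]]] := @esum_Xi_le _ _ _ _ xi a rho mu L actP rhoP muP muND must
  lenL weakP RD.
pose A n := gmean (conv_pow mu n) (fun s => - ln (Xi xi rho s)).
pose H n := shannon_entropy (conv_pow mu n).
have powE n : gmean (conv_pow mu n) I = (n%:R * h)%:E.
  exact: (@gmean_conv_pow_log_energy _ _ _ _ xi a rho mu).
have pP n := conv_pow_prob n muP.
have p0 n s : 0 <= conv_pow mu n s by exact: prob_ge0.
have leA n : (2%:E * A n <= (n%:R * h)%:E)%E.
  rewrite -powE -gmeanZ//; apply: le_gmean => // s _.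
  rewrite mulrN -mulNr; exact: (@neg_ln_Xi_le _ _ _ _ xi a rho mu).
have leH n : ((n%:R * h)%:E <= H n)%E.
  by rewrite -powE; apply: le_entropy => //; exact: stationary_conv_pow.
have HA (eps : R) : 0 < eps -> exists2 K, 0 <= K &
    forall n, (H n <= 2%:E * A n + (eps * n%:R + K)%:E)%E.
  (* The log-moment enters with factor [2 * d]; the extra [1] keeps the denominator positive when
     [d = 0]. *)
  move=> eps0; pose e := eps / (2 * d%:R + 1).
  have d0 : 0 < 2 * d%:R + 1 :> R by rewrite ltr_wpDl// mulr_ge0.
  have e0 : 0 < e by rewrite divr_gt0.
  have [K K0 leK] := log_moment_sublinear muP lenL logL e0.
  exists (2 * d%:R * K + C) => [|n]; first by rewrite addr_ge0// !mulr_ge0.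
  (* The comparison weight for Gibbs' inequality: at most one pointwise, with total mass at most
     [C]. *)
  pose q s := Xi xi rho s ^+ 2 / ((1 + L s) ^+ d) ^+ 2.
  have L1 s : 1 <= 1 + L s by rewrite lerDl (length_ge0 lenL).
  have L0 s : 0 < 1 + L s by exact: lt_le_trans (L1 s).
  have q01 s : 0 < q s <= 1.
    have /andP[x0 x1] := Xi01 s.
    rewrite divr_gt0 ?exprn_gt0//= ler_pdivrMr ?exprn_gt0// mul1r.
    apply: (@le_trans _ _ 1); first by rewrite exprn_ile1// ltW.
    by rewrite !exprn_ege1.
  have lnq s : - ln (q s) = 2 * - ln (Xi xi rho s) + 2 * d%:R * ln (1 + L s).
    have /andP[x0 _] := Xi01 s.
    rewrite ln_div ?posrE ?exprn_gt0// !lnXn ?exprn_gt0//; ring.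
  apply: (le_trans (shannon_entropy_le_cross (pP n) q01)).
  under [X in gmean _ X]eq_fun do rewrite lnq.
  rewrite gmeanD//; last 2 first.
  - by move=> s; rewrite mulr_ge0.
  - by move=> s; rewrite !mulr_ge0.
  rewrite !gmeanZ// ?mulr_ge0// -addeA; apply: leeD2l.
  (* Since [eps = 2 * d * e + e], the last [e * n] is slack to be dropped. *)
  have -> : eps * n%:R + (2 * d%:R * K + C) =
      (2 * d%:R * (e * n%:R + K) + C) + e * n%:R.
    by rewrite /e; field; rewrite gt_eqF.
  apply: (@le_trans _ _ (2 * d%:R * (e * n%:R + K) + C)%:E).
    rewrite EFinD; apply: leeD => //; rewrite [leRHS]EFinM.
    apply: lee_wpmul2l; last exact: leK.
    by rewrite lee_fin mulr_ge0.
  by rewrite lee_fin lerDl mulr_ge0// ltW.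
have cvgH : (fun n => ((n%:R^-1)%:E * H n)%E) @ \oo --> h%:E.
  apply: cvg_inv_nat_mul => eps eps0; have [K K0 HAK] := HA _ eps0.
  exists K => // n; apply/andP; split.
    by apply: le_trans (leH n); rewrite lee_fin gerBl addr_ge0// mulr_ge0// ltW.
  apply: le_trans (HAK n) _; rewrite [leRHS]EFinD; exact: leeD2r.
have avezE : avez_entropy mu = h%:E by exact: cvg_lim cvgH.
split; first by rewrite avezE -hE; exact: (@furstenberg_entropyE _ _ _ _ xi a rho mu).
rewrite avezE.
have -> : (fun n : nat => ((2 * n%:R^-1)%:E * A n)%E) =
    (fun n => ((n%:R^-1)%:E * (2%:E * A n))%E).
  by apply/funext => n; rewrite muleA -EFinM mulrC.
apply: cvg_inv_nat_mul => eps eps0; have [K K0 HAK] := HA _ eps0.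
exists K => // n; apply/andP; split.
  (* The lower bound for [2 * A n] comes from [n * h <= H n] followed by the upper bound on
     [H n]. *)
  by rewrite EFinB leeBlDr//; exact: le_trans (leH n) (HAK n).
by apply: le_trans (leA n) _; rewrite lee_fin lerDl addr_ge0// mulr_ge0// ltW.
Qed.
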